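(* Consider the variant of the Deferred-Revelation Auction (DRA) over a public ledger, described in the context, in which the ledger knows and enforces a fixed feasibility constraint $\mathcal{F}$ (so the auctioneer cannot misreport it). For any fixed downward-closed feasibility constraint $\mathcal{F}$ that is not a matroid, the DRA is not credible for any collateral $f$, even in an instance with a single real bidder whose value is drawn from the exponential distribution with mean $1$.
   Context: A feasibility constraint $\mathcal{F}$ is a downward-closed family of subsets of a finite ground set $E$ of bidder slots (sets of bids that may be allocated simultaneously); it is a matroid if it additionally satisfies the augmentation property (if $A,B\in\mathcal{F}$, $|A|>|B|$, then $B\cup\{a\}\in\mathcal{F}$ for some $a\in A\setminus B$). Values are independent, bidders quasi-linear; virtual value $\varphi(v)=v-\frac{1-F(v)}{f(v)}$. The exponential distribution with mean $1$ has CDF $1-e^{-t}$, virtual value $v-1$, monopoly reserve $1$. DRA over a public ledger (visible to all) with a perfectly hiding, perfectly binding, non-malleable commitment scheme: (1) every participant (real bidders and any fake bids fabricated by the auctioneer, each occupying an element of $E$) commits to a bid and deposits collateral $f$; the auctioneer reports distributions $\hat D_j$ (virtual values $\hat\varphi_j$) for all committed bids (it may choose the distributions of fake bids arbitrarily); (2) each committed bid is revealed or concealed, and collateral of concealed bids is burnt; (3) among revealed bids, the set $S\in\mathcal{F}$ maximizing $\sum_{i\in S}\hat\varphi_i(b_i)$ (lexicographic tie-breaking) is allocated, each allocated bidder paying its critical bid. The auctioneer chooses which fake bids to conceal after seeing revealed real bids. Its revenue is real bidders' payments minus burnt collateral of its concealed fake bids. The DRA is credible for collateral $f$ if, when real bidders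 bid truthfully, the auctioneer maximizes expected revenue by fabricating no bids and reporting true distributions. *)

(* Defs.v *)
From HB Require Import structures.
From mathcomp Require Import all_boot all_order all_algebra.
From mathcomp Require Import all_classical all_reals all_analysis.
Set Implicit Arguments. Unset Strict Implicit. Unset Printing Implicit Defensive.
Import Order.TTheory GRing.Theory Num.Theory.
Local Open Scope classical_set_scope.
Local Open Scope ring_scope.

Section DRA.
Variables (R : realType) (E : finType).

Definition downward_closed (F : {set {set E}}) : Prop :=
  forall A B : {set E}, B \subset A -> A \in F -> B \in F.

Definition matroid (F : {set {set E}}) : Prop :=
  downward_closed F /\
  forall A B : {set E}, A \in F -> B \in F -> (#|B| < #|A|)%N ->
    exists2 a, a \in A :\: B & a |: B \in F.

Definition is_density (p : R -> R) : Prop :=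
  [/\ forall x, 0 <= p x,
      measurable_fun setT p &
      (\int[@lebesgue_measure R]_(t in setT) (p t)%:E = 1)%E].

Definition cdf (p : R -> R) (x : R) : R :=
  fine (\int[@lebesgue_measure R]_(t in [set t : R | (t <= x)%R]) (p t)%:E)%E.

Definition virtual_value (p : R -> R) (v : R) : R := v - (1 - cdf p v) / p v.

Definition exp_pdf (x : R) : R := if 0 <= x then expR (- x) else 0.

Definition lex_prefers (S T : {set E}) : Prop :=
  exists i : E, [/\ i \in S, i \notin T &
    forall j : E, (enum_rank j < enum_rank i)%N -> (j \in S) = (j \in T)].

Definition weight (phis : E -> R -> R) (b : E -> R) (S : {set E}) : R :=
  \sum_(i in S) phis i (b i).

Definition chosen (F : {set {set E}}) (Rv : {set E}) (phis : E -> R -> R)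
    (b : E -> R) (S : {set E}) : Prop :=
  [/\ S \in F, S \subset Rv,
      (forall T, T \in F -> T \subset Rv -> weight phis b T <= weight phis b S) &
      (forall T, T \in F -> T \subset Rv ->
         weight phis b T = weight phis b S -> T != S -> lex_prefers S T)].

Definition allocated F Rv phis (b : E -> R) (i : E) : Prop :=
  exists2 S, chosen F Rv phis b S & i \in S.

Definition upd (b : E -> R) (i : E) (x : R) : E -> R :=
  fun j => if j == i then x else b j.

Definition critical_bid F Rv phis (b : E -> R) (i : E) : R :=
  inf [set x : R | allocated F Rv phis (upd b i x) i].

Definition payment F Rv phis (b : E -> R) (i : E) : R :=
  if `[< allocated F Rv phis b i >] then critical_bid F Rv phis b i else 0.

(** A strategy of the auctioneer when a single real bidder occupies slot e0:
    the set of slots with fabricated bids, the committed fake bids,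
    the reported densities (for all committed bids, including the real one)
    and the concealment rule (which fake bids to conceal, as a function of
    the revealed real bid). *)
Record strategy := Strategy {
  fake : {set E};
  fake_bid : E -> R;
  report : E -> R -> R;
  conceal : R -> {set E} }.

Definition valid_strategy (e0 : E) (s : strategy) : Prop :=
  [/\ e0 \notin fake s,
      (forall e, e \in e0 |: fake s -> is_density (report s e)) &
      (forall v, conceal s v \subset fake s)].

Definition revealed (e0 : E) (s : strategy) (v : R) : {set E} :=
  e0 |: (fake s :\: conceal s v).

Definition bids (e0 : E) (s : strategy) (v : R) : E -> R :=
  fun e => if e == e0 then v else fake_bid s e.

Definition revenue (F : {set {set E}}) (f : R) (e0 : E) (s : strategy) (v : R) : R :=
  payment F (revealed e0 s v) (fun e => virtual_value (report s e)) (bids e0 s v) e0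
  - f * #|conceal s v|%:R.

Definition weighted_revenue F f e0 s (v : R) : \bar R :=
  (revenue F f e0 s v * exp_pdf v)%:E.

Definition expected_revenue F f e0 s : \bar R :=
  (\int[@lebesgue_measure R]_(v in setT) weighted_revenue F f e0 s v)%E.

Definition honest : strategy :=
  Strategy (@finset.set0 E) (fun _ => 0) (fun _ => exp_pdf) (fun _ => (@finset.set0 E)).

Definition credible (F : {set {set E}}) (f : R) (e0 : E) : Prop :=
  forall s : strategy, valid_strategy e0 s ->
    (@lebesgue_measure R).-integrable setT (weighted_revenue F f e0 s) ->
    (expected_revenue F f e0 s <= expected_revenue F f e0 honest)%E.

End DRA.

(* Main.v *)
Require Import Defs.
From HB Require Import structures.
From mathcomp Require Import all_boot all_order all_algebra.
From mathcomp Require Import all_classical all_reals all_analysis.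
From mathcomp Require Import measurable_realfun lra.
Import Order.TTheory GRing.Theory Num.Theory.
Set Implicit Arguments. Unset Strict Implicit. Unset Printing Implicit Defensive.
Local Open Scope ring_scope.

(** The auctioneer fabricates bids of virtual value [K] on a set [W] such that
    the largest feasible subsets of [e0 |: W] contain [e0] and have one element
    more than those of [W], while some [B \subset W] is feasible but
    [e0 |: B] is not; failure of augmentation provides them.
    With all fake bids revealed, [e0] raises the rank by one, so its critical
    virtual value is [0] and its price is the monopoly price [1].  Concealing
    [W :\: B] leaves [e0] competing with [B], which it can only join by
    displacing an element, so the price jumps to some [p >= 1 + K].  Concealing
    exactly when the real bid exceeds [p] earns at least as much as honesty
    everywhere, and strictly more above [p] once [K > f * #|E|]; the exponential
    distribution gives positive mass to bids above [p]. *)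

(** * The exponential distribution and its tail integrals *)

Section exponential.
Local Open Scope classical_set_scope.
Variable R : realType.
Local Notation mu := (@lebesgue_measure R).
Local Notation epdf := (@exp_pdf R).

Lemma exp_pdfE : epdf = exponential_pdf 1.
Proof.
apply/funext => x; rewrite /exp_pdf; case: ifPn => [x0|].
  by rewrite exponential_pdfE// mul1r mulN1r.
by rewrite -ltNge => /lt0_exponential_pdf->.
Qed.

Lemma exp_pdf_ge0 (x : R) : 0 <= epdf x.
Proof. by rewrite exp_pdfE exponential_pdf_ge0. Qed.

Lemma measurable_exp_pdf : measurable_fun setT epdf.
Proof. by rewrite exp_pdfE; exact: measurable_exponential_pdf. Qed.

Lemma integrable_exp_pdf : mu.-integrable setT (EFin \o epdf).
Proof. by rewrite exp_pdfE; exact: integrable_exponential_pdf. Qed.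

Lemma is_density_exp_pdf : is_density epdf.
Proof.
split; [exact: exp_pdf_ge0 | exact: measurable_exp_pdf |].
by rewrite exp_pdfE; exact: integral_exponential_pdf.
Qed.

Lemma cdf_exp_pdf (x : R) : 0 <= x -> Defs.cdf epdf x = 1 - expR (- x).
Proof.
move=> x0; rewrite /Defs.cdf integral_mkcond.
have -> : (fun t => (epdf t)%:E) \_ [set t | t <= x] =
          (fun t => (epdf t)%:E) \_ `[0, x]%classic.
  apply/funext => t; rewrite /patch !mem_setE /= in_itv /=.
  by case: (leP 0 t) => [//|t0] /=; case: ifP => // _; rewrite /exp_pdf leNgt t0.
rewrite -integral_mkcond exp_pdfE.
move: x0; rewrite le_eqVlt => /orP[/eqP <-|x0].
  by rewrite set_itv1 integral_set1 oppr0 expR0 subrr.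
by have := @exponential_prob_itv0c R 1 x x0; rewrite /exponential_prob mulN1r => ->.
Qed.

Lemma virtual_value_exp_pdf (x : R) : 0 <= x -> virtual_value epdf x = x - 1.
Proof.
move=> x0; rewrite /virtual_value cdf_exp_pdf// /exp_pdf x0 subKr divff//.
by rewrite gt_eqF ?expR_gt0.
Qed.

(* [exp_pdf] vanishes at negative [x], and the division by it gives [0]. *)
Lemma virtual_value_exp_pdf_lt0 (x : R) : x < 0 -> virtual_value epdf x = x.
Proof. by move=> x0; rewrite /virtual_value /exp_pdf leNgt x0 invr0 mulr0 subr0. Qed.

(** The ray is closed for [b = true] and open for [b = false]. Both are needed because lexicographic
    tie-breaking decides whether a bid equal to the price wins. *)
Definition upper_ray (b : bool) (r : R) : set R :=
  [set` Interval (BSide b r) (BInfty _ false)].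

Lemma upper_rayE b r : upper_ray b r = [set x | r < x ?<= if b].
Proof. by apply/seteqP; split => x; rewrite /upper_ray /= in_itv /= andbT. Qed.

Lemma indic_upper_ray b r (v : R) :
  \1_(upper_ray b r) v = (r < v ?<= if b)%R%:R :> R.
Proof. by rewrite indicE upper_rayE mem_setE. Qed.

Lemma integral_upper_ray b r :
  (\int[mu]_(x in upper_ray b r) (epdf x)%:E =
   \int[mu]_(x in upper_ray true r) (epdf x)%:E)%E.
Proof.
case: b => //; apply: integral_itv_obnd_cbnd.
by apply/measurable_EFinP; apply: measurable_funTS; exact: measurable_exp_pdf.
Qed.

Lemma integrable_upper_ray b r : mu.-integrable (upper_ray b r) (EFin \o epdf).
Proof.
apply: integrableS integrable_exp_pdf => //; exact: measurable_itv.
Qed.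

Lemma integral_upper_ray_gt0 b r : 0 <= r ->
  (0 < \int[mu]_(x in upper_ray b r) (epdf x)%:E)%E.
Proof.
move=> r0; rewrite integral_upper_ray.
(* On [[r, r + 1]] the density is at least its value at the right end, a positive constant. *)
apply: (@lt_le_trans _ _
  (\int[mu]_(x in `[r, (r + 1)%R]) (expR (- (r + 1)%R)%R)%:E)%E).
  rewrite integral_cst//= lebesgue_measure_itv /= lte_fin ltrDl ltr01.
  by rewrite -EFinB addrAC subrr add0r mule1 lte_fin expR_gt0.
apply: (@le_trans _ _ (\int[mu]_(x in `[r, (r + 1)%R]) (epdf x)%:E)%E).
  apply: ge0_le_integral => //.
  - by apply/measurable_EFinP; apply: measurable_funTS; exact: measurable_exp_pdf.
  - move=> x /=; rewrite in_itv /= => /andP[rx xr].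
    by rewrite lee_fin /exp_pdf (le_trans r0 rx) ler_expR lerN2.
apply: ge0_subset_integral => //.
- exact: measurable_itv.
- by apply/measurable_EFinP; apply: measurable_funTS; exact: measurable_exp_pdf.
- by move=> x _; rewrite lee_fin exp_pdf_ge0.
- by move=> x; rewrite upper_rayE /= in_itv /= => /andP[].
Qed.

Lemma integral_exp_pdf_indic b r (c : R) :
  mu.-integrable setT (fun v => (c * \1_(upper_ray b r) v * epdf v)%:E) /\
  (\int[mu]_v (c * \1_(upper_ray b r) v * epdf v)%:E =
   c%:E * \int[mu]_(x in upper_ray true r) (epdf x)%:E)%E.
Proof.
have mr : measurable (upper_ray b r) by exact: measurable_itv.
have eqf : (fun v => (\1_(upper_ray b r) v * epdf v)%:E) =
    (EFin \o epdf) \_ (upper_ray b r).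
  apply/funext => v; rewrite /patch indicE.
  by case: ifP => _ /=; rewrite ?mul1r ?mul0r.
have intf : mu.-integrable setT (fun v => (\1_(upper_ray b r) v * epdf v)%:E).
  rewrite eqf -integrable_mkcond//; exact: integrable_upper_ray.
have -> : (fun v => (c * \1_(upper_ray b r) v * epdf v)%:E) =
    (fun v => c%:E * (\1_(upper_ray b r) v * epdf v)%:E)%E.
  by apply/funext => v; rewrite -EFinM mulrA.
split; first exact: integrableZl.
by rewrite integralZl// eqf -integral_mkcond integral_upper_ray.
Qed.

(** Here [h] will be the honest revenue and [g] that of the deviation. Endpoints are null, so the
    rays at [1] contribute equally whatever [b] and [b'] are, and the gap is [D] times the positive
    mass above [p]. *)
Lemma two_price_integral_gt (b b' : bool) (p D : R) : 0 < D -> 0 <= p ->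
  let h v := (\1_(upper_ray b 1) v * epdf v)%:E in
  let g v := ((\1_(upper_ray b' 1) v + D * \1_(upper_ray false p) v) * epdf v)%:E in
  mu.-integrable setT g /\ (\int[mu]_v h v < \int[mu]_v g v)%E.
Proof.
move=> D0 p0 h g.
have [_ hE] := integral_exp_pdf_indic b 1 1.
have [g1i g1E] := integral_exp_pdf_indic b' 1 1.
have [g2i g2E] := integral_exp_pdf_indic false p D.
have -> : h = fun v => (1 * \1_(upper_ray b 1) v * epdf v)%:E.
  by apply/funext => v; rewrite mul1r.
have -> : g = (fun v => (1 * \1_(upper_ray b' 1) v * epdf v)%:E) \+
     (fun v => (D * \1_(upper_ray false p) v * epdf v)%:E).
  by apply/funext => v; rewrite /g /= -EFinD mul1r mulrDl.
split; first exact: integrableD.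
rewrite integralD// hE g1E g2E mul1e.
(* Cancelling the common term in the extended reals requires it to be finite. *)
rewrite lteDl ?mule_gt0 ?lte_fin ?integral_upper_ray_gt0//.
apply: integrable_fin_num; first exact: measurable_itv.
exact: integrable_upper_ray.
Qed.

End exponential.

(** * The lexicographic order on sets of slots *)

Section lexicographic.
Variable E : finType.
Implicit Types S T U : {set E}.

Lemma lex_prefers_trans T S U :
  lex_prefers S T -> lex_prefers T U -> lex_prefers S U.
Proof.
move=> [i [iS iT iE]] [j [jT jU jE]].
have [ij|ji|eij] := ltngtP (enum_rank i) (enum_rank j).
- exists i; split => //; first by rewrite -jE.
  by move=> k ki; rewrite iE// jE// (ltn_trans ki).
- exists j; split => //; first by rewrite iE.
  by move=> k kj; rewrite iE ?jE// (ltn_trans kj).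
- by move: iT; rewrite (enum_rank_inj (ord_inj eij)) jT.
Qed.

Lemma lex_prefers_total S T : S != T -> lex_prefers S T \/ lex_prefers T S.
Proof.
move=> neST.
have [i0 i0P] : exists i, (i \in S) != (i \in T).
  apply/existsP; apply: contraNT neST; rewrite negb_exists => /forallP H.
  by apply/eqP/setP => i; have := H i; rewrite negbK => /eqP.
have [i iP imin] := @arg_minnP _ i0 (fun i => (i \in S) != (i \in T))
  (fun i => enum_rank i : nat) i0P.
have agree j : (enum_rank j < enum_rank i)%N -> (j \in S) = (j \in T).
  by move=> ji; apply/eqP; apply: contraTT ji => /imin; rewrite -leqNgt.
move: iP; case iS : (i \in S); case iT : (i \in T) => // _.
- by left; exists i; rewrite iS iT.
- by right; exists i; rewrite iS iT; split => // j /agree.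
Qed.

Lemma lex_prefers_max (G : {set {set E}}) S0 : S0 \in G ->
  exists2 S, S \in G & forall T, T \in G -> T != S -> lex_prefers S T.
Proof.
have [n] := ubnP #|G|; elim: n G S0 => // n IHn G S0 + S0G.
rewrite (cardsD1 S0 G) S0G add1n ltnS => ltGn.
have [G0|[S1 S1G]] := set_0Vmem (G :\ S0).
  exists S0 => // T TG neT; have : T \in G :\ S0 by rewrite !inE neT.
  by rewrite G0 inE.
have [S /setD1P[neS SG] Smax] := IHn _ _ ltGn S1G.
have [S0S|SS0] : lex_prefers S0 S \/ lex_prefers S S0.
  by apply: lex_prefers_total; rewrite eq_sym.
  exists S0 => // T TG neT; have [->//|neTS] := eqVneq T S.
  by apply: lex_prefers_trans S0S _; apply: Smax => //; rewrite !inE neT.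
exists S => // T TG neT; have [->//|neTS] := eqVneq T S0.
by apply: Smax => //; rewrite !inE neTS.
Qed.

End lexicographic.

(** * Allocation and critical bids *)

Section allocation.
Variables (R : realType) (E : finType) (F : {set {set E}}) (Rv : {set E}).
Variables (phis : E -> R -> R).
Implicit Types (b : E -> R) (S T : {set E}).

(** Maximize the weight first, then take the lexicographically preferred set among the
    maximizers. *)
Lemma exists_chosen b S0 : S0 \in F -> S0 \subset Rv ->
  exists S, chosen F Rv phis b S.
Proof.
move=> S0F S0R.
have S0P : (S0 \in F) && (S0 \subset Rv) by rewrite S0F.
have [S1 /andP[S1F S1R] S1max] := @Order.TotalTheory.arg_maxP _ _ _ S0
  (fun S => (S \in F) && (S \subset Rv)) (weight phis b) S0P.
pose G := [set T in F | (T \subset Rv) && (weight phis b T == weight phis b S1)].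
have S1G : S1 \in G by rewrite !inE S1F S1R eqxx.
have [S + Smax] := lex_prefers_max S1G.
rewrite !inE => /and3P[SF SR /eqP SE]; exists S; split => //.
- by move=> T TF TR; rewrite SE; apply: S1max; rewrite TF.
- move=> T TF TR TE neT; apply: Smax => //.
  by rewrite !inE TF TR TE SE eqxx.
Qed.

(** Strict dominance over every set avoiding [i] settles the allocation without looking at ties. *)
Lemma allocated_of_weight b i S : S \in F -> S \subset Rv ->
  (forall T, T \in F -> T \subset Rv -> i \notin T ->
    weight phis b T < weight phis b S) ->
  allocated F Rv phis b i.
Proof.
move=> SF SR Slt; have [T Tch] := exists_chosen b SF SR; exists T => //.
case: Tch => TF TR Tmax _; apply: contraT => iT.
by have := Slt _ TF TR iT; rewrite ltNge Tmax.
Qed.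

Lemma not_allocated_of_weight b i S : S \in F -> S \subset Rv ->
  (forall T, T \in F -> T \subset Rv -> i \in T ->
    weight phis b T < weight phis b S) ->
  ~ allocated F Rv phis b i.
Proof.
move=> SF SR Slt [T [TF TR Tmax _] iT].
by have := Slt _ TF TR iT; rewrite ltNge Tmax.
Qed.

Lemma upd_id b i : upd b i (b i) = b.
Proof. by apply/funext => j; rewrite /upd; case: eqP => [->|]. Qed.

(** The infimum defining the critical bid is [p] whether or not a bid of exactly [p] wins; that
    undetermined case survives only as the boolean of the comparison. *)
Lemma payment_threshold b i (p : R) :
  (forall x, p < x -> allocated F Rv phis (upd b i x) i) ->
  (forall x, x < p -> ~ allocated F Rv phis (upd b i x) i) ->
  payment F Rv phis b i =
    p * (p < b i ?<= if `[< allocated F Rv phis (upd b i p) i >])%R%:R.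
Proof.
move=> above below.
have crit : critical_bid F Rv phis b i = p.
  rewrite /critical_bid; set A := [set x | _]%classic.
  have lbA : lbound A p by move=> x Ax; rewrite leNgt; apply/negP => /below.
  have hA : has_inf A.
    by split; [exists (p + 1); apply: above; rewrite ltrDl | exists p].
  apply/eqP; rewrite eq_le lb_le_inf//; last by case: hA.
  rewrite andbT; apply/ler_addgt0Pr => e e0; apply: ge_inf; first by exists p.
  by apply: above; rewrite ltrDl.
have := above (b i); have := below (b i); rewrite /payment crit upd_id => Hb Ha.
have [lt|gt|eq] := ltgtP (b i) p.
- rewrite asboolF; last exact: Hb.
  by case: asboolP => _ /=; rewrite ?(lt_geF lt) ?(lt_gtF lt) mulr0.
- rewrite asboolT; last exact: Ha.
  by case: asboolP => _ /=; rewrite ?(ltW gt) ?gt mulr1.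
- rewrite -eq upd_id; case: asboolP => _ /=; rewrite ?lexx ?ltxx ?mulr1 ?mulr0//.
Qed.

End allocation.

(** * The price faced by [e0] against identical fake bids *)

Section exponential_auction.
Variables (R : realType) (E : finType) (F : {set {set E}}).
Variables (Rv : {set E}) (e0 : E) (K : R).

Lemma weight_exp b (T : {set E}) : 0 <= K ->
  (forall j, j \in Rv -> j != e0 -> b j = K + 1) -> T \subset Rv ->
  weight (fun=> virtual_value (@exp_pdf R)) b T =
    (if e0 \in T then virtual_value (@exp_pdf R) (b e0) else 0) + K * #|T :\ e0|%:R.
Proof.
move=> K0 bK TR; rewrite /weight (big_setID [set e0]) /=.
congr (_ + _).
  case: ifPn => eT.
    by rewrite (big_pred1 e0) // => j; rewrite !inE andbC; case: eqP => // ->.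
  by rewrite big_pred0 // => j; rewrite !inE andbC; case: eqP => // ->; exact: negbTE.
rewrite (eq_bigr (fun=> K)) => [|j].
  by rewrite sumr_const mulr_natr.
rewrite !inE => /andP[je jT]; rewrite bK ?(fintype.subsetP TR)//.
by rewrite virtual_value_exp_pdf ?addrK// addr_ge0.
Qed.

(** The best weight without [e0] is [K * #|S0|], and with it [x - 1 + K * #|S1 :\ e0|] for a bid
    [x >= 0]; [p] is the bid equating the two. *)
Lemma payment_exp b (S0 S1 : {set E}) : 0 <= K ->
  (forall j, j \in Rv -> j != e0 -> b j = K + 1) ->
  downward_closed F ->
  S0 \in F -> S0 \subset Rv -> e0 \notin S0 ->
  (forall T, T \in F -> T \subset Rv -> e0 \notin T -> (#|T| <= #|S0|)%N) ->
  S1 \in F -> S1 \subset Rv -> e0 \in S1 ->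
  (forall T, T \in F -> T \subset Rv -> e0 \in T -> (#|T| <= #|S1|)%N) ->
  let p := 1 + K * (#|S0|%:R - #|S1 :\ e0|%:R) in
  exists a : bool, forall v,
    payment F Rv (fun=> virtual_value (@exp_pdf R)) (upd b e0 v) e0 =
    p * (p < v ?<= if a)%R%:R.
Proof.
move=> K0 bK DC S0F S0R eS0 S0max S1F S1R eS1 S1max p.
exists `[< allocated F Rv (fun=> virtual_value (@exp_pdf R)) (upd b e0 p) e0 >] => v.
have updK x j : j \in Rv -> j != e0 -> upd b e0 x j = K + 1.
  by move=> jR je; rewrite /upd (negbTE je) bK.
have updE x : upd b e0 x e0 = x by rewrite /upd eqxx.
have updupd x : upd (upd b e0 v) e0 x = upd b e0 x.
  by apply/funext => j; rewrite /upd; case: eqP.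
have wE x (T : {set E}) : T \subset Rv ->
    weight (fun=> virtual_value (@exp_pdf R)) (upd b e0 x) T =
    (if e0 \in T then virtual_value (@exp_pdf R) x else 0) + K * #|T :\ e0|%:R.
  by move=> TR; rewrite (weight_exp K0 (updK x) TR) updE.
have S1D : (#|S1 :\ e0| <= #|S0|)%N.
  apply: S0max; rewrite ?in_setD1 ?eqxx//; first exact: DC (subD1set _ _) S1F.
  exact: fintype.subset_trans (subD1set _ _) S1R.
(* Bids above [p] are thus nonnegative, where the virtual value is [x - 1]. *)
have p1 : 1 <= p by rewrite lerDl mulr_ge0// subr_ge0 ler_nat.
have outD (T : {set E}) : e0 \notin T -> #|T :\ e0| = #|T|.
  by move=> eT; rewrite [RHS](cardsD1 e0) (negbTE eT).
have inD (T : {set E}) : T \in F -> T \subset Rv -> e0 \in T ->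
    (#|T :\ e0| <= #|S1 :\ e0|)%N.
  move=> TF TR eT; have := S1max _ TF TR eT.
  by rewrite (cardsD1 e0) (cardsD1 e0 S1) eT eS1.
rewrite (@payment_threshold _ _ _ _ _ _ _ p) ?updE ?updupd// => x; rewrite updupd => px.
- apply: (allocated_of_weight S1F S1R) => T TF TR eT.
  rewrite !wE// (negbTE eT) eS1 virtual_value_exp_pdf; last first.
    by rewrite (le_trans _ (ltW px))// (le_trans _ p1).
  rewrite add0r outD//.
  have : K * #|T|%:R <= K * #|S0|%:R by rewrite ler_wpM2l// ler_nat S0max.
  by move: px; rewrite /p mulrBr; lra.
- apply: (not_allocated_of_weight S0F S0R) => T TF TR eT.
  rewrite !wE// (negbTE eS0) eT add0r (outD S0 eS0).
  have : K * #|T :\ e0|%:R <= K * #|S1 :\ e0|%:R by rewrite ler_wpM2l// ler_nat inD.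
  have [x0|x0] := leP 0 x.
    by rewrite virtual_value_exp_pdf//; move: px; rewrite /p mulrBr; lra.
  (* A negative bid has virtual value [x < 0], so adding [e0] only lowers the weight. *)
  have : K * #|S1 :\ e0|%:R <= K * #|S0|%:R by rewrite ler_wpM2l// ler_nat.
  by rewrite virtual_value_exp_pdf_lt0//; lra.
Qed.

End exponential_auction.

(** * Combinatorics of failed augmentation *)

(** Let [A], [B] violate augmentation and take a minimal [X] inside [A :\: B] such that [B :|: X]
    contains a feasible set larger than [B]. Any [e0] in [X] works with [W = B :|: (X :\ e0)]: by
    minimality [B] is a largest feasible subset of [W], and restoring [e0] raises the maximum by
    exactly one. *)
Lemma not_matroid_witness (E : finType) (F : {set {set E}}) :
  downward_closed F -> ~ matroid F ->
  exists (e0 : E) (B W : {set E}),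
    [/\ B \in F, e0 \notin W, B \subset W, e0 |: B \notin F &
     (forall T, T \in F -> T \subset W -> #|T| <= #|B|)%N /\
     exists T, [/\ T \in F, T \subset e0 |: W, e0 \in T, #|T| = #|B|.+1 &
     forall T, T \in F -> T \subset e0 |: W -> #|T| <= #|B|.+1]%N].
Proof.
move=> DC nM.
have [A [B [AF BF ltBA noaug]]] : exists A B, [/\ A \in F, B \in F, (#|B| < #|A|)%N &
    forall a, a \in A :\: B -> a |: B \notin F].
  apply: contrapT => H; apply: nM; split=> // A B AF BF ltBA.
  apply: contrapT => H'; apply: H; exists A, B; split => // a aAB.
  by apply/negP => aBF; apply: H'; exists a.
pose big (X : {set E}) :=
  (X \subset A :\: B) && [exists T in F, (T \subset B :|: X) && (#|B| < #|T|)%N].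
have bigAB : big (A :\: B).
  rewrite /big subxx /=; apply/exists_inP; exists A => //; rewrite ltBA andbT.
  by apply/fintype.subsetP => x xA; rewrite !inE xA andbT orbN.
have [X /andP[XAB /exists_inP[T TF /andP[TBX ltBT]]] Xmin] :=
  @arg_minnP _ _ big (fun X => #|X|) bigAB.
have [X0|[e0 eX]] := set_0Vmem X.
  by move: (subset_leq_card TBX); rewrite X0 finset.setU0 leqNgt ltBT.
have eAB := fintype.subsetP XAB _ eX.
have eB : e0 \notin B by move: eAB; rewrite !inE => /andP[].
pose W := B :|: (X :\ e0).
have eW : e0 \notin W by rewrite !inE eqxx orbF.
have WE : e0 |: W = B :|: X by rewrite finset.setUCA finset.setD1K.
have Wle U : U \in F -> U \subset W -> (#|U| <= #|B|)%N.
  move=> UF UW; rewrite leqNgt; apply/negP => ltBU.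
  suff /Xmin : big (X :\ e0) by rewrite [X in (X <= _)%N](cardsD1 e0) eX ltnn.
  rewrite /big (fintype.subset_trans (subD1set _ _) XAB) /=.
  by apply/exists_inP; exists U; rewrite ?UW.
have Ule U : U \in F -> U \subset e0 |: W -> (#|U| <= #|B|.+1)%N.
  move=> UF UW; rewrite (cardsD1 e0) -[leqRHS]add1n leq_add ?leq_b1//.
  by apply: Wle; [exact: DC (subD1set _ _) UF | rewrite subDset].
exists e0, B, W; split => //; [exact: finset.subsetUl | exact: noaug |].
split=> //; exists T; rewrite WE; split=> //.
(* If [T] avoided [e0] it would lie in [W] and be no larger than [B]. *)
- apply: contraLR ltBT => eT; rewrite -leqNgt; apply: Wle => //.
  by rewrite -(setU1K eW) subsetD1 WE TBX eT.
- by apply/eqP; rewrite eqn_leq ltBT Ule// WE.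
- by move=> U UF UW; apply: Ule => //; rewrite WE.
Qed.

(** * The profitable deviation *)

Theorem mainTheorem4 (R : realType) (E : finType) (F : {set {set E}}) :
  downward_closed F -> ~ matroid F ->
  forall f : R, 0 <= f ->
  exists e0 : E, ~ credible F f e0.
Proof.
move=> DC nM f f0.
have [e0 [B [W [BF eW BW eBF [Wle [T [TF TW eT cT Tle]]]]]]] :=
  not_matroid_witness DC nM.
have eB : e0 \notin B by apply: contra eW; exact: fintype.subsetP.
have e0F : [set e0] \in F by apply: DC TF; rewrite finset.sub1set.
have set0F : (finset.set0 : {set E}) \in F by apply: DC TF; exact: finset.sub0set.
(* [K > f * #|E|]: the price increase dwarfs any amount of burnt collateral. *)
pose K : R := f * #|E|%:R + 1.
have K0 : 0 <= K by rewrite addr_ge0// mulr_ge0.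
pose bK (j : E) := K + 1.
have bKE j : bK j = K + 1 by [].
(* Honest play: [S0] is empty and [S1 = [set e0]], so the price is the monopoly reserve [1]. *)
have [h1 honestE] : exists a : bool, forall v,
    payment F [set e0] (fun=> virtual_value (@exp_pdf R)) (upd (fun=> 0) e0 v) e0 =
    (1 < v ?<= if a)%R%:R.
  have [||T' _ T'e eT'|||T' _ T'e eT'|a aE] := @payment_exp R E F [set e0] e0 K
    (fun=> 0) finset.set0 [set e0] K0 _ DC set0F (finset.sub0set _) _ _ e0F _ _ _.
  - by move=> j; rewrite inE => ->.
  - by rewrite inE.
  - move: T'e eT'; rewrite subset1 => /orP[] /eqP-> //.
    by rewrite set11.
  - exact: subxx.
  - exact: set11.
  - exact: subset_leq_card.
  - by exists a => v; rewrite aE finset.setDv cards0 subrr mulr0 addr0 mul1r.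
(* All fake bids revealed: [T :\ e0] has as many elements as [B], so the [K] term of the price
   cancels. *)
have [at1 revE] : exists a : bool, forall v,
    payment F (e0 |: W) (fun=> virtual_value (@exp_pdf R)) (upd bK e0 v) e0 =
    (1 < v ?<= if a)%R%:R.
  have [|||a aE] := @payment_exp R E F (e0 |: W) e0 K
    bK B T K0 (fun j _ _ => bKE j) DC BF _ eB _ TF TW eT _.
  - by rewrite (fintype.subset_trans BW)// finset.subsetUr.
  - move=> U UF UW eU; apply: Wle => //.
    by rewrite -(setU1K eW) subsetD1 UW.
  - by move=> U UF UW _; rewrite cT Tle.
  - exists a => v; rewrite aE.
    move: cT; rewrite (cardsD1 e0) eT add1n => -[->].
    by rewrite subrr mulr0 addr0 mul1r.
(* Only [B] left revealed: since [e0 |: B] is infeasible, a largest feasible set [S] containing [e0]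
   has [#|S :\ e0| < #|B|], which adds at least [K] to the price. *)
have [p [ac [pK concE]]] : exists (p : R) (a : bool), 1 + K <= p /\ forall v,
    payment F (e0 |: B) (fun=> virtual_value (@exp_pdf R)) (upd bK e0 v) e0 =
    p * (p < v ?<= if a)%R%:R.
  have S0P : [&& [set e0] \in F, [set e0] \subset e0 |: B & e0 \in [set e0]].
    by rewrite e0F finset.subsetUl set11.
  have [S /and3P[SF SB eS] Smax] := @arg_maxnP _ _
    (fun S => [&& S \in F, S \subset e0 |: B & e0 \in S]) (fun S => #|S|) S0P.
  have [|||a aE] := @payment_exp R E F (e0 |: B) e0 K
    bK B S K0 (fun j _ _ => bKE j) DC BF _ eB _ SF SB eS _.
  - exact: finset.subsetUr.
  - move=> U UF UB eU; apply: Wle => //; apply: fintype.subset_trans BW.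
    by rewrite -(setU1K eB) subsetD1 UB.
  - by move=> U UF UB eU; apply: Smax; rewrite UF UB.
  - eexists _, a; split; last exact: aE.
    rewrite lerD2l -[leLHS]mulr1 ler_wpM2l// lerBrDr nat1r ler_nat.
    have : S \proper e0 |: B.
      by rewrite finset.properEneq SB andbT; apply: contraNneq eBF => <-.
    by move=> /proper_card; rewrite (cardsD1 e0) (cardsU1 e0) eS eB !add1n ltnS.
pose C := W :\: B.
pose s := Strategy W bK (fun=> @exp_pdf R) (fun v => if p < v then C else finset.set0).
have CE : f * #|C|%:R < K.
  by rewrite /K ltr_pwDr// ler_wpM2l// ler_nat max_card.
(* Gain over the price [1] from a concealment, net of the burnt collateral. *)
pose D := p - f * #|C|%:R - 1.
have D0 : 0 < D by rewrite /D; lra.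
have p1 : 1 <= p by lra.
have honest_rev v : revenue F f e0 (honest R E) v = \1_(upper_ray h1 1) v.
  rewrite /revenue /revealed /honest /= cards0 mulr0 subr0 finset.setD0 finset.setU0.
  by rewrite (_ : bids _ _ _ = upd (fun=> 0) e0 v)// honestE indic_upper_ray.
(* Concealment happens only for [p < v], where [e0] wins both auctions regardless of ties; otherwise
   the price stays [1]. *)
have s_rev v : revenue F f e0 s v =
    \1_(upper_ray at1 1) v + D * \1_(upper_ray false p) v.
  rewrite /revenue /revealed /s /= !indic_upper_ray lteifF.
  rewrite (_ : bids _ _ _ = upd bK e0 v)//; case: ltP => pv.
    rewrite (_ : W :\: C = B); last first.
      by rewrite finset.setDDr finset.setDv finset.set0U; exact/finset.setIidPr.
    by rewrite concE ?lteifS ?(le_lt_trans p1 pv)// /D !mulr1 [RHS]addrC subrK.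
  by rewrite finset.setD0 revE cards0 !mulr0 subr0 addr0.
exists e0 => /(_ s) cred.
have [] := @two_price_integral_gt R h1 at1 p D D0 (le_trans ler01 p1).
have -> : (fun v => ((\1_(upper_ray at1 1) v + D * \1_(upper_ray false p) v) *
    exp_pdf v)%:E) = weighted_revenue F f e0 s.
  by apply/funext => v; rewrite /weighted_revenue s_rev.
have -> : (fun v => (\1_(upper_ray h1 1) v * exp_pdf v)%:E) =
    weighted_revenue F f e0 (honest R E).
  by apply/funext => v; rewrite /weighted_revenue honest_rev.
move=> sint; rewrite ltNge => /negP; apply; apply: cred => //.
split => //= [e _|v]; first exact: is_density_exp_pdf.
by case: ifP => _; [exact: subsetDl | exact: finset.sub0set].
Qed.
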